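(* For every positive integer $k\leq 12$, there is no tournament $T$ having two distinct minimal $\tau$-retentive sets $R_1$ and $R_2$ with $|R_1|=3$ and $|R_2|=k$.
   Context: A tournament $T$ consists of a finite vertex set $V(T)$ and an asymmetric, complete binary relation $\succ$ on $V(T)$ ($x$ dominates $y$ if $x\succ y$). For $v\in V(T)$ let $N^-_T(v)=\{u\in V(T): u\succ v\}$; for $B\subseteq V(T)$, $T[B]$ is the induced subtournament. The tournament equilibrium set $\tau$ is defined recursively: a nonempty $A\subseteq V(T)$ is $\tau$-retentive if for every $v\in A$ with $N^-_T(v)\neq\emptyset$, $\tau(T[N^-_T(v)])\subseteq A$; $A$ is a minimal $\tau$-retentive set if no $\tau$-retentive set of $T$ is a proper subset of $A$; $\tau(T)$ is the union of all minimal $\tau$-retentive sets of $T$. *)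

(* Defs.v *)
From mathcomp Require Import all_boot.
Set Implicit Arguments.
Unset Strict Implicit.
Unset Printing Implicit Defensive.

Record tournament := Tournament {
  vertex :> finType;
  dom : rel vertex;
  dom_asym : forall x y, dom x y -> ~~ dom y x;
  dom_complete : forall x y, x != y -> dom x y || dom y x
}.

Section TournamentEquilibriumSet.
Variable T : tournament.
Implicit Types (A B : {set T}) (v : T).

(* An induced subtournament T[B] is represented by its vertex set B, which  *)
(* is an argument of every notion below; T itself is the case B = [set: T]. *)
Definition in_nbhd B v : {set T} := [set u in B | dom u v].

Definition retentive_for (f : {set T} -> {set T}) B A : bool :=
  [&& A != set0, A \subset B &
      [forall v in A, (in_nbhd B v != set0) ==> (f (in_nbhd B v) \subset A)]].

(* The recursion defining tau is on in-neighbourhoods, which are smaller    *)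
(* than B; n bounds the recursion depth, and n = #|B| suffices: see tauE.   *)
Fixpoint tau_rec (n : nat) B : {set T} :=
  if n is m.+1
  then \bigcup_(A : {set T} | minset (retentive_for (tau_rec m) B) A) A
  else set0.

Definition tau B : {set T} := tau_rec #|B| B.

Definition retentive B A : bool := retentive_for tau B A.

Definition min_retentive B A : bool := minset (retentive B) A.

Lemma in_nbhd_proper B v : v \in B -> in_nbhd B v \proper B.
Proof.
move=> vB; apply/properP; split; first by apply/subsetP=> u; rewrite inE => /andP[].
exists v => //; rewrite inE vB /=; apply/negP => dvv.
by have := dom_asym dvv; rewrite dvv.
Qed.

Lemma eq_retentive_for f g B :
    (forall v, v \in B -> f (in_nbhd B v) = g (in_nbhd B v)) ->
  retentive_for f B =1 retentive_for g B.
Proof.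
move=> fg A; rewrite /retentive_for; case: (A != set0) => //=.
case: (boolP (A \subset B)) => //= /subsetP sAB.
by apply: eq_forallb => v; case: (boolP (v \in A)) => //= vA; rewrite fg ?sAB.
Qed.

Lemma tau_rec0 n : tau_rec n set0 = set0.
Proof.
case: n => //= n; rewrite big_pred0 // => A; apply/negP => /minsetp /and3P[A0].
by rewrite subset0 (negPf A0).
Qed.

Lemma tau_rec_fuel n B : #|B| <= n -> tau_rec n B = tau B.
Proof.
rewrite /tau; move: {2}#|B| (leqnn #|B|) => m.
elim: m n B => [|m IHm] n B lBm lBn; case: (eqVneq B set0) lBm lBn => [->|B0];
  rewrite ?tau_rec0 // -?[B == set0]cards_eq0 => lBm lBn.
  by move: lBm; rewrite leqn0 cards_eq0 (negPf B0).
case EB: #|B| => [|p]; first by rewrite -cards_eq0 EB in B0.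
case: n lBn => [|n] lBn; first by rewrite EB in lBn.
rewrite /=; apply: eq_bigl => A; apply: minset_eq => {}A.
apply: eq_retentive_for => v vB.
have lt := proper_card (in_nbhd_proper vB).
rewrite (IHm n) 1?(IHm p) //.
all: by rewrite -ltnS ?(leq_trans lt) // -EB.
Qed.

Lemma tauE B : tau B = \bigcup_(A : {set T} | min_retentive B A) A.
Proof.
rewrite -(tau_rec_fuel (leqnSn #|B|)) /=.
apply: eq_bigl => A; apply: minset_eq => {}A; apply: eq_retentive_for => v vB.
by apply: tau_rec_fuel; rewrite ltnW // proper_card // in_nbhd_proper.
Qed.

End TournamentEquilibriumSet.

(* Main.v *)
(* A three-element minimal retentive set R1 = {p, q, r} is a 3-cycle no two of *)
(* whose elements have a common dominator. By disjointness every vertex of the *)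
(* other set R2 then dominates exactly one of p, q, r, since otherwise R1      *)
(* would be retentive in its in-neighbourhood. The crux is that a minimal      *)
(* retentive set M of B, with M inside R2 and p, q in B, has at least six      *)
(* elements. If some x in M dominates r, pass to the in-neighbourhood of x,    *)
(* which still contains p and q. Otherwise colour each element of M by which   *)
(* of p, q it dominates: if {y} is retentive in the in-neighbourhood of x,     *)
(* then y has the other colour, and this rules out at most five elements. So   *)
(* all indegrees within R2 are at least six, whereas some indegree is at most  *)
(* (|R2| - 1) / 2.                                                             *)
Require Import Defs.
From mathcomp Require Import all_boot.
From mathcomp Require Import zify.
Set Implicit Arguments.
Unset Strict Implicit.
Unset Printing Implicit Defensive.

(** The engine is a descent: a minimal retentive set contains a minimal retentive set of the
    in-neighbourhood of each of its dominated elements ([min_retentive_in_nbhd]). Applied inside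
    [R1] it gives the 3-cycle without pairwise common dominators ([min_retentive3]). Applied to a
    vertex [v] of [R2] of indegree below six within [R2] ([exists_small_indegree], where the bound
    12 enters), it gives a minimal retentive set with at most five elements in an in-neighbourhood
    that contains the two elements of [R1] not dominated by [v]. This contradicts
    [six_le_min_retentive], which reduces to the colouring argument [two_coloured_card]. *)

Section Retentive.
Variable T : tournament.
Implicit Types (A B M : {set T}) (x y z : T).

(** * Basic properties of domination and minimal retentive sets *)

Lemma domxx x : dom x x = false.
Proof. by apply/negP => d; have := dom_asym d; rewrite d. Qed.

Lemma dom_anti x y : dom x y -> dom y x -> False.
Proof. by move=> /dom_asym/negP. Qed.

Lemma dom_neq x y : dom x y -> x <> y.
Proof. by move=> d e; rewrite e domxx in d. Qed.

Lemma dominated (R : {set T}) x y :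
  x \notin R -> y \in R -> dom y x = false -> dom x y.
Proof.
move=> xR yR d; have neq : y != x by apply: contraNneq xR => <-.
by have := dom_complete neq; rewrite d.
Qed.

Lemma tau_sub B : tau B \subset B.
Proof.
rewrite tauE; apply/bigcupsP => A /minsetp.
by case/and3P.
Qed.

Lemma in_nbhd_sub B x : in_nbhd B x \subset B.
Proof. by apply/subsetP => u; rewrite inE => /andP[]. Qed.

Lemma retentive_full B : B != set0 -> retentive B B.
Proof.
move=> B0; apply/and3P; split=> //; apply/forall_inP => v _; apply/implyP => _.
exact: subset_trans (tau_sub _) (in_nbhd_sub _ _).
Qed.

Lemma exists_min_retentive B A :
  retentive B A -> exists2 M, min_retentive B M & M \subset A.
Proof. by move=> /minset_exists[M mM sMA]; exists M. Qed.

Lemma min_retentive_sub_tau B M : min_retentive B M -> M \subset tau B.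
Proof. by move=> mM; rewrite tauE; apply: bigcup_sup. Qed.

Lemma min_retentive_neq0 B M : min_retentive B M -> M != set0.
Proof. by move=> /minsetp/and3P[]. Qed.

Lemma min_retentive_sub B M : min_retentive B M -> M \subset B.
Proof. by move=> /minsetp/and3P[]. Qed.

Lemma retentive_tau B A x :
  retentive B A -> x \in A -> in_nbhd B x != set0 -> tau (in_nbhd B x) \subset A.
Proof. by case/and3P => _ _ /forall_inP H xA; apply: implyP (H x xA). Qed.

Lemma min_retentive_in_nbhd B M x :
    min_retentive B M -> x \in M -> in_nbhd B x != set0 ->
  exists2 M', min_retentive (in_nbhd B x) M' & M' \subset M.
Proof.
move=> /minsetp rM xM N0.
have [M' mM' _] := exists_min_retentive (retentive_full N0).
exists M' => //; apply: subset_trans (min_retentive_sub_tau mM') _.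
exact: retentive_tau rM xM N0.
Qed.

(** A nonempty intersection would itself be retentive, so by minimality it would equal both sets. *)
Lemma min_retentive_disjoint B M1 M2 :
  min_retentive B M1 -> min_retentive B M2 -> M1 <> M2 -> M1 :&: M2 = set0.
Proof.
move=> m1 m2 neq; apply/eqP; apply/negPn/negP => I0; apply: neq.
have rI : retentive B (M1 :&: M2).
  apply/and3P; split=> //.
    exact: subset_trans (subsetIl _ _) (min_retentive_sub m1).
  apply/forall_inP => v; rewrite inE => /andP[v1 v2]; apply/implyP => N0.
  by rewrite subsetI (retentive_tau (minsetp m1)) ?(retentive_tau (minsetp m2)).
by rewrite -(minsetinf m1 rI (subsetIl _ _)) {1}(minsetinf m2 rI (subsetIr _ _)).
Qed.

Lemma min_retentive_undominated B M x :
  min_retentive B M -> x \in M -> in_nbhd B x = set0 -> M = [set x].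
Proof.
move=> mM xM N0; apply/esym; apply: (minsetinf mM); rewrite ?sub1set //.
apply/and3P; split; first by apply/set0Pn; exists x; rewrite set11.
  by rewrite sub1set (subsetP (min_retentive_sub mM)).
by apply/forall_inP => v /set1P ->; rewrite N0 eqxx.
Qed.

(** Otherwise the descent would place [y] in its own in-neighbourhood. *)
Lemma min_retentive1 B y : min_retentive B [set y] -> in_nbhd B y = set0.
Proof.
move=> m; apply/eqP/negPn/negP => N0.
have [M' mM' sM'] := min_retentive_in_nbhd m (set11 y) N0.
have /set0Pn[z zM'] := min_retentive_neq0 mM'.
have := subsetP (min_retentive_sub mM') _ zM'.
by rewrite (set1P (subsetP sM' _ zM')) inE domxx andbF.
Qed.

Lemma min_retentive_in_neighbour B M x :
    min_retentive B M -> x \in M -> M <> [set x] ->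
  exists2 y, y \in M & dom y x.
Proof.
move=> mM xM neq.
have N0 : in_nbhd B x != set0.
  by apply/eqP => N0; apply: neq; apply: min_retentive_undominated mM xM N0.
have [M' mM' sM'] := min_retentive_in_nbhd mM xM N0.
have /set0Pn[z zM'] := min_retentive_neq0 mM'.
exists z; first exact: (subsetP sM').
by have := subsetP (min_retentive_sub mM') _ zM'; rewrite inE => /andP[].
Qed.

(* An element dominating nothing in M lies in no [tau (in_nbhd B v)], v in M, *)
(* so removing it would leave a smaller retentive set.                        *)
Lemma min_retentive_out_neighbour B M x :
    min_retentive B M -> x \in M -> M <> [set x] ->
  exists2 y, y \in M & dom x y.
Proof.
move=> mM xM neq.
have [/exists_inP// | /exists_inPn noy] := boolP [exists y in M, dom x y].
have rM := minsetp mM.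
have : M :\ x = M.
  apply: (minsetinf mM); rewrite ?subD1set //; apply/and3P; split.
  - have [y yM yx] := min_retentive_in_neighbour mM xM neq.
    by apply/set0Pn; exists y; rewrite !inE yM; move/eqP: (dom_neq yx) => ->.
  - exact: subset_trans (subD1set _ _) (min_retentive_sub mM).
  apply/forall_inP => v; rewrite !inE => /andP[_ vM]; apply/implyP => N0.
  rewrite subsetD1 (retentive_tau rM) //=; apply/negP => xt.
  have := subsetP (tau_sub _) _ xt; rewrite inE => /andP[_ xv].
  by have := noy v vM; rewrite xv.
by move=> E; move: xM; rewrite -E !inE eqxx.
Qed.

(** * Small minimal retentive sets, undominated vertices and indegrees *)

Lemma min_retentive_le2 B M :
  min_retentive B M -> #|M| <= 2 -> exists2 y, M = [set y] & in_nbhd B y = set0.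
Proof.
move=> mM; have M0 := min_retentive_neq0 mM.
rewrite leq_eqVlt => /orP[/cards2P[x [y [xy E]]]|]; last first.
  rewrite ltnS leq_eqVlt ltnS leqn0 cards_eq0 (negPf M0) orbF => /cards1P[y E].
  by exists y => //; apply: min_retentive1; rewrite -E.
have in_nb u : u \in M -> exists2 v, v \in M & dom v u.
  move=> uM; apply: (min_retentive_in_neighbour mM uM) => Eu.
  by have := cards2 x y; rewrite -E Eu cards1 xy.
(* Two elements would have to dominate each other. *)
have [|u] := in_nb x; rewrite ?E ?set21 // => /set2P[]-> d1.
  by rewrite domxx in d1.
have [|u'] := in_nb y; rewrite ?E ?set22 // => /set2P[]-> d2.
  by case: (dom_anti d1 d2).
by rewrite domxx in d2.
Qed.

(** Every element has an in-neighbour in [M], so [M] is a 3-cycle and that in-neighbour is unique.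
    The descent at [x] can then only reach [[set y]], and [min_retentive1] leaves [x] and [y]
    without a common dominator. *)
Lemma min_retentive3 B M : min_retentive B M -> #|M| = 3 ->
  exists x y z,
    [/\ M = [set x; y; z],
        [/\ dom y x, dom z y & dom x z] &
        [/\ in_nbhd (in_nbhd B x) y = set0, in_nbhd (in_nbhd B y) z = set0
          & in_nbhd (in_nbhd B z) x = set0]].
Proof.
move=> mM cM.
have in_nb u : u \in M -> exists2 v, v \in M & dom v u.
  move=> uM; apply: (min_retentive_in_neighbour mM uM) => Eu.
  by move: cM; rewrite Eu cards1.
have /set0Pn[x xM] := min_retentive_neq0 mM.
have [y yM yx] := in_nb x xM.
have [z zM zy] := in_nb y yM.
have zx : z <> x by move=> E; rewrite E in zy; apply: dom_anti yx zy.
have E : M = [set x; y; z].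
  apply/esym/eqP; rewrite eqEcard cM; apply/andP; split.
    by apply/subsetP => u; rewrite !inE => /orP[/orP[]|] /eqP->.
  have nyx := introF eqP (dom_neq yx); have nzy := introF eqP (dom_neq zy).
  by rewrite setUC cardsU1 cards2 !inE nzy (introF eqP zx) eq_sym nyx.
have [u uM uz] := in_nb z zM.
have xz : dom x z.
  move: uM uz; rewrite E !inE => /orP[/orP[]|] /eqP-> // d; last by rewrite domxx in d.
  by case: (dom_anti zy d).
have empty v w t : M = [set v; w; t] -> dom w v -> dom v t ->
    in_nbhd (in_nbhd B v) w = set0.
  move=> Ev wv vt.
  have vM : v \in M by rewrite Ev !inE eqxx.
  have wM : w \in M by rewrite Ev !inE eqxx orbT.
  have N0 : in_nbhd B v != set0.
    by apply/set0Pn; exists w; rewrite inE wv (subsetP (min_retentive_sub mM)).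
  have [M' mM' sM'] := min_retentive_in_nbhd mM vM N0.
  suff Ew : M' = [set w] by apply: min_retentive1; rewrite -Ew.
  apply/eqP; rewrite eqEsubset sub1set.
  have sw : M' \subset [set w].
    apply/subsetP => u' u'M'; rewrite inE.
    have := subsetP (min_retentive_sub mM') _ u'M'; rewrite inE => /andP[_ d].
    have := subsetP sM' _ u'M'; rewrite Ev !inE => /orP[/orP[]|] // /eqP Eu.
      by rewrite Eu domxx in d.
    by rewrite Eu in d; case: (dom_anti vt d).
  have /set0Pn[u' u'M'] := min_retentive_neq0 mM'.
  by rewrite sw -(set1P (subsetP sw _ u'M')).
exists x, y, z; split => //; split.
- exact: empty E yx xz.
- by apply: (empty y z x) => //; rewrite E -setUA setUC.
- by apply: (empty z x y) => //; rewrite E setUC setUA.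
Qed.

(** Any other element [x] of a minimal retentive set is dominated by [y], which is still undominated
    in the in-neighbourhood of [x]; by induction on size, [y] belongs to the set, which is therefore
    [[set y]]. *)
Lemma tau_undominated B y : y \in B -> in_nbhd B y = set0 -> tau B = [set y].
Proof.
move: {2}#|B| (leqnn #|B|) => n; elim: n B => [|n IH] B lB yB N0.
  by move: lB yB; rewrite leqn0 cards_eq0 => /eqP->; rewrite inE.
have only M : min_retentive B M -> M = [set y].
  move=> mM; have sMB := min_retentive_sub mM.
  suff yM : y \in M by apply: min_retentive_undominated mM yM N0.
  have /set0Pn[x xM] := min_retentive_neq0 mM.
  have [-> // | neq] := eqVneq y x.
  have yx : dom y x.
    case/orP: (dom_complete neq) => // xy.
    have : x \in in_nbhd B y by rewrite inE xy (subsetP sMB).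
    by rewrite N0 inE.
  have yN : y \in in_nbhd B x by rewrite inE yB.
  have Nx : in_nbhd B x != set0 by apply/set0Pn; exists y.
  have /subsetP := retentive_tau (minsetp mM) xM Nx; apply.
  rewrite IH ?set11 //.
    rewrite -ltnS; apply: leq_trans lB.
    exact/proper_card/in_nbhd_proper/(subsetP sMB).
  apply/eqP; rewrite -subset0 -N0; apply/subsetP => u.
  by rewrite !inE => /andP[/andP[-> _]].
have [|M mM _] := exists_min_retentive (@retentive_full B _).
  by apply/set0Pn; exists y.
apply/eqP; rewrite eqEsubset -{2}(only M mM) min_retentive_sub_tau // andbT tauE.
by apply/bigcupsP => A /only ->.
Qed.

(** Indegrees and outdegrees within [R] have equal sums, so the average indegree is half of
    [#|R|.-1], which is less than [n]. *)
Lemma exists_small_indegree (R : {set T}) n :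
  R != set0 -> #|R| <= n.*2 -> exists2 v, v \in R & #|in_nbhd R v| < n.
Proof.
move=> R0 cR.
have [/exists_inP// | /exists_inPn big] := boolP [exists v in R, #|in_nbhd R v| < n].
have card_in v : #|in_nbhd R v| = \sum_(u in R) dom u v.
  rewrite -sum1_card big_mkcond [RHS]big_mkcond /=; apply: eq_bigr => u _.
  by rewrite inE; case: (u \in R) => //; case: (dom u v).
have deg v : v \in R -> \sum_(u in R) dom u v + \sum_(u in R) dom v u = #|R|.-1.
  move=> vR; rewrite -big_split /= (cardsD1 v) vR /= (bigD1 v) //= domxx addn0 add0n.
  rewrite -sum1_card; apply: eq_big => u; first by rewrite !inE andbC.
  case/andP => _ uv; have := dom_complete uv.
  by case: (boolP (dom u v)) => [/dom_asym/negPf->|_ /= ->].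
have low : n * #|R| <= \sum_(v in R) \sum_(u in R) dom u v.
  rewrite mulnC -sum_nat_const; apply: leq_sum => v vR.
  by rewrite -card_in leqNgt big.
have : \sum_(v in R) (\sum_(u in R) dom u v + \sum_(u in R) dom v u) = #|R| * #|R|.-1.
  by rewrite -sum_nat_const; apply: eq_bigr => v; apply: deg.
rewrite big_split /= [X in _ + X]exchange_big /=.
move: R0; rewrite -cards_eq0; nia.
Qed.

(** * Two-coloured minimal retentive sets *)

(* If M has at most five elements, then every x in M has an in-neighbour y   *)
(* (a link) such that no vertex of B dominates both x and y. Links alternate *)
(* colours, and five consecutive ones would visit six distinct vertices.     *)
Section TwoColoured.
Variables (B M : {set T}) (c : T -> bool).
Hypothesis mM : min_retentive B M.
Hypothesis M_dominated : forall x, x \in M -> in_nbhd B x != set0.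
(** Both colour hypotheses hold when each colour class has a common dominator in [B]: vertices
    without a common dominator cannot all have one colour. *)
Hypothesis c_alternates : forall x y, x \in M -> y \in M -> dom y x ->
  in_nbhd (in_nbhd B x) y = set0 -> c y != c x.
Hypothesis c_second_level : forall x y z, x \in M -> y \in M -> z \in M ->
    dom y x -> dom z x -> dom z y ->
    in_nbhd (in_nbhd (in_nbhd B x) y) z = set0 ->
  c y = c x -> c z != c x.

Let e x y := [&& y \in M, dom y x & in_nbhd (in_nbhd B x) y == set0].

Lemma linkM x y : e x y -> y \in M. Proof. by case/and3P. Qed.
Lemma link_dom x y : e x y -> dom y x. Proof. by case/and3P. Qed.
Lemma link_colour x y : x \in M -> e x y -> c y = ~~ c x.
Proof.
move=> xM /and3P[yM d /eqP N0]; have := c_alternates xM yM d N0.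
by case: (c x); case: (c y).
Qed.
Lemma link_cover x y z : e x y -> z \in M -> dom z x -> dom z y -> False.
Proof.
case/and3P=> _ _ /eqP N0 zM zx zy.
have : z \in in_nbhd (in_nbhd B x) y.
  by rewrite !inE zx zy (subsetP (min_retentive_sub mM)).
by rewrite N0 inE.
Qed.

Lemma link_min_retentive x M' : min_retentive (in_nbhd B x) M' ->
  M' \subset M -> #|M'| <= 2 -> exists2 y, y \in M' & e x y.
Proof.
move=> mM' sM' c2; have [y E N0] := min_retentive_le2 mM' c2.
have yM' : y \in M' by rewrite E set11.
exists y => //; rewrite /e N0 eqxx (subsetP sM') //=.
by have := subsetP (min_retentive_sub mM') _ yM'; rewrite inE => /andP[_ ->].
Qed.

Lemma link_two x u v : x \in M ->
  (forall z, z \in M -> dom z x -> z = u \/ z = v) -> e x u \/ e x v.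
Proof.
move=> xM uv.
have [M' mM' sM'] := min_retentive_in_nbhd mM xM (M_dominated xM).
have uvM' z : z \in M' -> z = u \/ z = v.
  move=> zM'; apply: uv; first exact: (subsetP sM').
  by have := subsetP (min_retentive_sub mM') _ zM'; rewrite inE => /andP[].
have [|y yM' ey] := link_min_retentive mM' sM'.
  apply: (@leq_trans #|[set u; v]|); last by rewrite cards2; case: eqP.
  by apply/subset_leq_card/subsetP => z /uvM'[] ->; rewrite !inE eqxx ?orbT.
by case: (uvM' y yM') => <-; [left|right].
Qed.

(** Colours and domination leave only one possible link from each of [p], [w] and [s]: they go to
    [w], [s] and [p] respectively. This closed chain of three links cannot alternate two colours. *)
Lemma no_cycle_below x w p q s :
    M = [set x; w] :|: [set p; q; s] -> dom x w ->
    dom p x -> dom q x -> dom s x -> dom q p -> dom s q -> dom p s ->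
  c p != c x -> c q != c x -> False.
Proof.
move=> EM xw px qx sx qp sq ps cp cq.
have inM z : z \in M -> z = x \/ z = w \/ z = p \/ z = q \/ z = s.
  by rewrite EM !inE => /orP[/orP[]|/orP[/orP[]|]] /eqP ->; tauto.
have [wM pM qM sM] : [/\ w \in M, p \in M, q \in M & s \in M].
  by rewrite EM !inE !eqxx !orbT.
have ew : e p w.
  have [z zM zp||//] := @link_two p q w pM.
  - have [Ez|[|[Ez|[|Ez]]]] := inM z zM; [|by right| |by left|]; subst z.
    + by case: (dom_anti zp px).
    + by rewrite domxx in zp.
    + by case: (dom_anti zp ps).
  - by move=> /(link_colour pM) E; move: cp cq; rewrite E; case: (c p); case: (c x).
have wp := link_dom ew; have cw := link_colour pM ew.
have [z zM zw|eE|eE] := @link_two w x s wM.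
- have [->|[Ez|[Ez|[Ez|->]]]] := inM z zM; [by left| | | |by right]; subst z.
  + by rewrite domxx in zw.
  + by case: (dom_anti zw wp).
  + by case: (link_cover ew qM qp zw).
- by move: cp (link_colour wM eE); rewrite cw; case: (c p); case: (c x).
have es : e s p.
  have [z zM zs|//|//] := @link_two s p p sM; left.
  have [Ez|[Ez|[->//|[Ez|Ez]]]] := inM z zM; subst z.
  - by case: (dom_anti zs sx).
  - by case: (dom_anti zs (link_dom eE)).
  - by case: (dom_anti zs sq).
  - by rewrite domxx in zs.
by move: (link_colour sM es) (link_colour wM eE); rewrite cw => ->; case: (c s).
Qed.

(** The descent at [x] avoids both [x] and an out-neighbour [w] of [x], so it yields at most three
    elements. Up to two give a link; three form a 3-cycle in which, by [c_second_level], at most one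
    vertex shares the colour of [x], and [no_cycle_below] applies after a rotation. *)
Lemma exists_link x : #|M| <= 5 -> x \in M -> exists y, e x y.
Proof.
move=> cM xM.
have [M' mM' sM'] := min_retentive_in_nbhd mM xM (M_dominated xM).
have [le2|gt2] := leqP #|M'| 2.
  by have [y _ ey] := link_min_retentive mM' sM' le2; exists y.
have M'x z : z \in M' -> dom z x.
  by move=> /(subsetP (min_retentive_sub mM')); rewrite inE => /andP[].
have [|w wM xw] := min_retentive_out_neighbour mM xM.
  move=> E; have := M_dominated xM; rewrite min_retentive1 ?eqxx //.
  by rewrite -E.
have sub : [set x; w] :|: M' \subset M.
  by rewrite subUset sM' andbT; apply/subsetP => z /set2P[] ->.
have card : #|[set x; w] :|: M'| = #|M'|.+2.
  rewrite cardsU cards2 (introF eqP (dom_neq xw)) /=.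
  suff -> : [set x; w] :&: M' = set0 by rewrite cards0 subn0.
  apply/setP => z; rewrite !inE; apply/negP => /andP[/orP[]/eqP-> /M'x].
    by rewrite domxx.
  exact: dom_anti.
have cM' : #|M'| = 3 by have := subset_leq_card sub; rewrite card; lia.
have EM : M = [set x; w] :|: M'.
  by apply/esym/eqP; rewrite eqEcard sub card cM'.
have [p [q [s [E [qp sq ps] [Npq Nqs Nsp]]]]] := min_retentive3 mM' cM'.
have [pM' qM' sM''] : [/\ p \in M', q \in M' & s \in M'].
  by rewrite E !inE !eqxx !orbT.
have [px qx sx] := And3 (M'x _ pM') (M'x _ qM') (M'x _ sM'').
have [pM qM sM] := And3 (subsetP sM' _ pM') (subsetP sM' _ qM') (subsetP sM' _ sM'').
have cpq := c_second_level xM pM qM px qx qp Npq.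
have cqs := c_second_level xM qM sM qx sx sq Nqs.
have csp := c_second_level xM sM pM sx px ps Nsp.
exfalso; have [cp|cp] := eqVneq (c p) (c x).
  have [cs|cs] := eqVneq (c s) (c x); first by have := csp cs; rewrite cp eqxx.
  apply: (@no_cycle_below x w q s p) => //; last exact: cpq.
  by rewrite EM E; congr (_ :|: _); rewrite -setUA setUC.
have [cq|cq] := eqVneq (c q) (c x).
  apply: (@no_cycle_below x w s p q) => //; last exact: cqs.
  by rewrite EM E; congr (_ :|: _); rewrite setUC setUA.
by apply: (@no_cycle_below x w p q s) => //; rewrite EM E.
Qed.

(** The first link forces [x0] to dominate [x2]. If [x4] were [x0], it would dominate both ends of
    the link from [x2] to [x3]. *)
Lemma link_chain_neq x0 x1 x2 x3 x4 : x0 \in M ->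
  e x0 x1 -> e x1 x2 -> e x2 x3 -> e x3 x4 -> x0 != x4.
Proof.
move=> M0 e1 e2 e3 e4; apply/eqP => E; subst x4.
have [M1 M2 M3] := And3 (linkM e1) (linkM e2) (linkM e3).
have d02 : dom x0 x2.
  have neq : x0 != x2.
    by apply/eqP => E; subst x2; apply: dom_anti (link_dom e1) (link_dom e2).
  have /orP[//|d] := dom_complete neq.
  by case: (link_cover e1 M2 d (link_dom e2)).
exact: link_cover e3 M0 d02 (link_dom e4).
Qed.

Lemma two_coloured_card : 5 < #|M|.
Proof.
rewrite ltnNge; apply/negP => cM.
have /set0Pn[x0 M0] := min_retentive_neq0 mM.
have [x1 e1] := exists_link cM M0; have M1 := linkM e1.
have [x2 e2] := exists_link cM M1; have M2 := linkM e2.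
have [x3 e3] := exists_link cM M2; have M3 := linkM e3.
have [x4 e4] := exists_link cM M3; have M4 := linkM e4.
have [x5 e5] := exists_link cM M4; have M5 := linkM e5.
have [c1 c2 c3] := And3 (link_colour M0 e1) (link_colour M1 e2) (link_colour M2 e3).
have [c4 c5] := conj (link_colour M3 e4) (link_colour M4 e5).
have n2 x y z : e x y -> e y z -> x != z.
  move=> exy eyz; apply/eqP => E; subst z.
  exact: dom_anti (link_dom exy) (link_dom eyz).
have nc x y : c x = ~~ c y -> y != x.
  by move=> E; apply/eqP => Exy; move: E; rewrite Exy; case: (c x).
(* Vertices at odd distance differ in colour; those at distance two differ by asymmetry, and those
   at distance four by [link_chain_neq]. *)
have U : uniq [:: x0; x1; x2; x3; x4; x5].
  rewrite /= !inE !negb_or !(n2 _ _ _ e1 e2, n2 _ _ _ e2 e3, n2 _ _ _ e3 e4, n2 _ _ _ e4 e5).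
  rewrite (link_chain_neq M0 e1 e2 e3 e4) (link_chain_neq M1 e2 e3 e4 e5).
  by rewrite !nc // ?c5 ?c4 ?c3 ?c2 ?c1 ?negbK.
have : size [:: x0; x1; x2; x3; x4; x5] <= #|M|.
  rewrite cardE; apply: uniq_leq_size => // z; rewrite mem_enum !inE.
  by do 5?[case/orP]; move/eqP->.
by rewrite leqNgt ltnS cM.
Qed.

End TwoColoured.

(** * Minimal retentive sets below two elements of the 3-cycle *)

Section ThreeClasses.
Variables (R : {set T}) (p q r : T).
Hypotheses (pR : p \notin R) (qR : q \notin R).
Hypothesis one : forall x, x \in R -> dom x p + dom x q + dom x r = 1.

Lemma six_le_min_retentive B M : p \in B -> q \in B -> M \subset R ->
  min_retentive B M -> 5 < #|M|.
Proof.
have dpq x : x \in R -> dom x r -> dom p x && dom q x.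
  move=> xR d; have := one xR; rewrite d.
  case dp: (dom x p); case dq: (dom x q) => // _.
  by rewrite (dominated pR) // (dominated qR).
move: {2}#|M| (leqnn #|M|) => n; elim: n B M => [|n IH] B M cM pB qB sMR mM.
  by move: (min_retentive_neq0 mM) cM; rewrite leqn0 cards_eq0 => /negPf->.
have MR x : x \in M -> x \in R by apply: (subsetP sMR).
have [/exists_inP[x xM xr]|/exists_inPn nor] := boolP [exists x in M, dom x r].
  have /andP[px qx] := dpq x (MR _ xM) xr.
  have pN : p \in in_nbhd B x by rewrite inE pB.
  have qN : q \in in_nbhd B x by rewrite inE qB.
  have [|M' mM' sM'] := min_retentive_in_nbhd mM xM.
    by apply/set0Pn; exists p.
  have ltM : #|M'| < #|M|.
    apply: proper_card; apply/properP; split=> //; exists x => //.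
    by apply/negP => /(subsetP (min_retentive_sub mM')); rewrite inE domxx andbF.
  apply: (ltn_trans _ ltM); apply: (IH (in_nbhd B x)) => //.
    by rewrite -ltnS (leq_trans ltM).
  exact: subset_trans sM' sMR.
(* With no element of [M] dominating [r], each dominates exactly one of [p] and [q]; [g] picks the
   other one, a common dominator of the colour class. *)
pose g (b : bool) := if b then p else q.
have gB b : g b \in B by case: b.
have gx x b : x \in M -> dom x q = b -> dom (g b) x.
  move=> xM; have := one (MR x xM); rewrite (negPf (nor x xM)).
  case: b => /= dp dq; apply: (@dominated R) => //; try exact: MR.
  by move: dp; rewrite dq; case: (dom x p).
apply: (@two_coloured_card B M (fun x => dom x q)) => //= [x xM|x y xM yM yx N0|x y z xM yM zM _ _ _ N0 Eyx].
- by apply/set0Pn; exists (g (dom x q)); rewrite inE gB gx.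
- apply/eqP => E; have : g (dom x q) \in in_nbhd (in_nbhd B x) y.
    by rewrite !inE gB !gx.
  by rewrite N0 inE.
apply/eqP => E; have : g (dom x q) \in in_nbhd (in_nbhd (in_nbhd B x) y) z.
  by rewrite !inE gB !gx.
by rewrite N0 inE.
Qed.

End ThreeClasses.
End Retentive.

(** * The contradiction between the two retentive sets *)

Theorem theorem4 (k : nat) (k_gt0 : 0 < k) (k_le12 : k <= 12) :
  ~ exists (T : tournament) (R1 R2 : {set T}),
      [/\ min_retentive [set: T] R1, min_retentive [set: T] R2,
          R1 <> R2, #|R1| = 3 & #|R2| = k].
Proof.
case=> T [R1 [R2 [m1 m2 neq c1 c2]]]; subst k.
have dis x : x \in R1 -> x \notin R2.
  move=> x1; apply/negP => x2; have := min_retentive_disjoint m1 m2 neq.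
  by move/setP/(_ x); rewrite !inE x1 x2.
have [p [q [r [E [qp rq pr] [Npq Nqr Nrp]]]]] := min_retentive3 m1 c1.
have [p1 q1 r1] : [/\ p \in R1, q \in R1 & r \in R1].
  by rewrite E !inE !eqxx !orbT.
have [pR qR rR] := And3 (dis _ p1) (dis _ q1) (dis _ r1).
have one x : x \in R2 -> dom x p + dom x q + dom x r = 1.
  move=> xR.
  move/setP/(_ x): (Npq); move/setP/(_ x): (Nqr); move/setP/(_ x): (Nrp).
  rewrite !inE /=.
  case dp: (dom x p); case dq: (dom x q); case dr: (dom x r) => // _ _ _.
  (* The remaining case is that [x] dominates none of [p], [q], [r]. Then [R1] is retentive in [B],
     so [tau B], which lies in [R2], meets [R1]. *)
  pose B := in_nbhd [set: T] x.
  have [pB qB rB] : [/\ p \in B, q \in B & r \in B].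
    by rewrite !inE (dominated pR) // (dominated qR) // (dominated rR).
  have tau1 u v : v \in B -> dom v u -> in_nbhd (in_nbhd setT u) v = set0 ->
      tau (in_nbhd B u) = [set v].
    move=> vB vu N0; apply: tau_undominated; first by rewrite inE vB.
    apply/eqP; rewrite -subset0 -N0; apply/subsetP => z.
    by rewrite !inE => /andP[/andP[_ ->]].
  have rR1 : retentive B R1.
    apply/and3P; split; first exact: min_retentive_neq0 m1.
      by rewrite E; apply/subsetP => z; rewrite in_setU !in_set1 => /orP[/set2P[]|/eqP] ->.
    apply/forall_inP => v; rewrite {1}E !inE => /orP[/orP[]|] /eqP ->;
      apply/implyP => _; [rewrite (tau1 _ q)|rewrite (tau1 _ r)|rewrite (tau1 _ p)] => //;
      by rewrite sub1set.
  have [M mM sM] := exists_min_retentive rR1.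
  have /set0Pn[z zM] := min_retentive_neq0 mM.
  have : z \in R2.
    have B0 : B != set0 by apply/set0Pn; exists p.
    apply: (subsetP (retentive_tau (minsetp m2) xR B0)).
    exact: (subsetP (min_retentive_sub_tau mM)).
  by rewrite (negPf (dis z (subsetP sM z zM))).
have [v vR lt6] := exists_small_indegree (n := 6) (min_retentive_neq0 m2) k_le12.
have NE t : t \notin R2 -> dom v t = false -> t \in in_nbhd setT v.
  by move=> tR d; rewrite !inE; exact: dominated tR vR d.
have N0 : in_nbhd setT v != set0.
  apply/set0Pn; have := one v vR.
  case dp: (dom v p); last by exists p; apply: NE.
  by case dq: (dom v q) => // _; exists q; apply: NE.
have [M mM sM] := min_retentive_in_nbhd m2 vR N0.
have : #|M| < 6.
  apply: leq_ltn_trans lt6; apply/subset_leq_card/subsetP => z zM.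
  have := subsetP (min_retentive_sub mM) z zM.
  by rewrite !inE (subsetP sM).
rewrite ltnNge => /negP; apply.
(* Whichever of [p], [q], [r] is dominated by [v], the other two lie in its in-neighbourhood and
   take the roles of [p] and [q] in [six_le_min_retentive]. *)
have := one v vR.
case dp: (dom v p).
  case dq: (dom v q) => //; case dr: (dom v r) => // _.
  apply: (@six_le_min_retentive T R2 q r p qR rR _ _ M (NE q qR dq) (NE r rR dr)) => // x xR.
  by rewrite -(one x xR) -[RHS]addnA addnC.
case dq: (dom v q).
  case dr: (dom v r) => // _.
  apply: (@six_le_min_retentive T R2 p r q pR rR _ _ M (NE p pR dp) (NE r rR dr)) => // x xR.
  by rewrite -(one x xR) addnAC.
move=> _.
exact: (@six_le_min_retentive T R2 p q r pR qR one _ M (NE p pR dp) (NE q qR dq)).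
Qed.
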